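(* Let $\{\Lambda_{x,j}\in\mathcal{L}(\mathcal{H},\mathcal{K}_{x,j}): x\in\mathcal{X}, j\in J\}$ be a semi-continuous $g$-frame for a Hilbert space $\mathcal{H}$ with respect to a measure space $(\mathcal{X},\mu)$, and let $\{\mathcal{G}_{x,j}: x\in\mathcal{X},j\in J\}$ be an alternate dual frame of it. Then for any $\lambda\in[0,1]$, every measurable $\mathcal{X}_1\subset\mathcal{X}$ (with $\mathcal{X}_1^c=\mathcal{X}\setminus\mathcal{X}_1$) and every $f\in\mathcal{H}$, $$\mathrm{Re}\Big\{\int_{\mathcal{X}_1^c}\sum_{j\in J}\langle\mathcal{G}_{x,j}f,\Lambda_{x,j}f\rangle d\mu(x)\Big\}+\Big\|\int_{\mathcal{X}_1}\sum_{j\in J}\Lambda_{x,j}^*\mathcal{G}_{x,j}f\,d\mu(x)\Big\|^2$$ $$=\mathrm{Re}\Big\{\int_{\mathcal{X}_1}\sum_{j\in J}\langle\mathcal{G}_{x,j}f,\Lambda_{x,j}f\rangle d\mu(x)\Big\}+\Big\|\int_{\mathcal{X}_1^c}\sum_{j\in J}\Lambda_{x,j}^*\mathcal{G}_{x,j}f\,d\mu(x)\Big\|^2$$ $$\ge(2\lambda-\lambda^2)\,\mathrm{Re}\Big\{\int_{\mathcal{X}_1}\sum_{j\in J}\langle\mathcal{G}_{x,j}f,\Lambda_{x,j}f\rangle d\mu(x)\Big\}+(1-\lambda^2)\,\mathrm{Re}\Big\{\int_{\mathcal{X}_1^c}\sum_{j\in J}\langle\mathcal{G}_{x,j}f,\Lambda_{x,j}f\rangle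 d\mu(x)\Big\}.$$
   Context: $\mathcal{H},\mathcal{K}$ are Hilbert spaces, $J$ is a countable index set, $(\mathcal{X},\mu)$ is a measure space with positive measure, $\{\mathcal{K}_{x,j}\}_{x\in\mathcal{X},j\in J}$ is a family of closed subspaces of $\mathcal{K}$, and $\mathcal{L}(\mathcal{H},\mathcal{K}_{x,j})$ is the space of bounded linear operators. A family $\{\Lambda_{x,j}\in\mathcal{L}(\mathcal{H},\mathcal{K}_{x,j})\}$ is a semi-continuous $g$-frame for $\mathcal{H}$ with respect to $(\mathcal{X},\mu)$ if for every $f\in\mathcal{H}$ and $j\in J$ the function $x\mapsto\Lambda_{x,j}(f)$ is measurable on $\mathcal{X}$, and there are constants $A,B>0$ with $A\|f\|^2\le\int_{\mathcal{X}}\sum_{j\in J}\|\Lambda_{x,j}(f)\|^2d\mu(x)\le B\|f\|^2$ for all $f\in\mathcal{H}$. A semi-continuous $g$-frame $\{\mathcal{G}_{x,j}\in\mathcal{L}(\mathcal{H},\mathcal{K}_{x,j})\}$ is an alternate dual frame of $\{\Lambda_{x,j}\}$ if for all $f\in\mathcal{H}$, $f=\int_{\mathcal{X}}\sum_{j}\Lambda_{x,j}^*\mathcal{G}_{x,j}f\,d\mu(x)=\int_{\mathcal{X}}\sum_{j}\mathcal{G}_{x,j}^*\Lambda_{x,j}f\,d\mu(x)$. Vector-valued integrals are understood weakly: $v=\int_{\mathcal{X}_1}\sum_j\Lambda_{x,j}^*\mathcal{G}_{x,j}f\,d\mu(x)$ means $\langle v,g\rangle=\int_{\mathcal{X}_1}\sum_j\langle\mathcal{G}_{x,j}f,\Lambda_{x,j}g\rangle\,d\mu(x)$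 for all $g\in\mathcal{H}$, and similarly with the roles of $\Lambda$ and $\mathcal{G}$ exchanged. The functions $x\mapsto\langle\mathcal{G}_{x,j}f,\Lambda_{x,j}g\rangle$ are measurable. *)

(* Defs.v *)
From HB Require Import structures.
From mathcomp Require Import all_boot all_order all_algebra.
From mathcomp Require Import all_classical all_reals all_analysis.
From mathcomp Require Import sesquilinear complex.

Set Implicit Arguments.
Unset Strict Implicit.
Unset Printing Implicit Defensive.

Import Order.TTheory GRing.Theory Num.Theory.
Import numFieldNormedType.Exports.

Local Open Scope classical_set_scope.
Local Open Scope ring_scope.
Local Open Scope complex_scope.

(* Complex Hilbert spaces. [inner u v] is linear in [u] and conjugate-linear
   in [v]. *)
HB.mixin Record NormedModule_isHilbert (R : realType) H
    of CompleteNormedModule R[i] H := {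
  inner : {dot H for @conjc R} ;
  normr_inner : forall u : H, `|u| ^+ 2 = inner u u
}.

#[short(type="hilbertType")]
HB.structure Definition Hilbert (R : realType) :=
  {H of CompleteNormedModule R[i] H & NormedModule_isHilbert R H}.

(* The library norm is R[i]-valued; this is the same number in [R]. *)
Definition hnorm (R : realType) (H : normedModType R[i]) (u : H) : R :=
  complex.Re `|u|.

Definition closed_subspace (R : realType) (K : hilbertType R) (V : set K) :=
  [/\ closed V, V 0 &
    forall (a : R[i]) u v, V u -> V v -> V (a *: u + v)].

Definition bounded_operator (R : realType) (H K : hilbertType R) (V : set K)
    (T : {linear H -> K}) :=
  bounded_near T (nbhs (0 : H)) /\ (forall f, V (T f)).

(* Borel measurability, for the norm topology of [Y]. *)
Definition borel_fun d (X : measurableType d) (Y : ptopologicalType)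
    (h : X -> Y) : Prop :=
  measurable_fun [set: X] (h : X -> g_sigma_algebraType (@open Y)).

(* \esum is meaningful for nonnegative terms only, hence the splitting into
   positive and negative parts. When the family is absolutely summable this is
   its unordered sum; otherwise the value is junk. *)
Definition sumR (R : realType) (J : choiceType) (a : J -> R) : R :=
  fine (\esum_(j in [set: J]) (a^\+ j)%:E) -
  fine (\esum_(j in [set: J]) (a^\- j)%:E).

Definition sumC (R : realType) (J : choiceType) (a : J -> R[i]) : R[i] :=
  sumR (fun j => complex.Re (a j)) +i* sumR (fun j => complex.Im (a j)).

Definition integralC d (X : measurableType d) (R : realType)
    (mu : {measure set X -> \bar R}) (D : set X) (h : X -> R[i]) : R[i] :=
  (\int[mu]_(x in D) complex.Re (h x)) +i* (\int[mu]_(x in D) complex.Im (h x)).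

Section GFrames.
Context {d : measure_display} {X : measurableType d} {R : realType}.
Context {J : countType} {H K : hilbertType R}.
Variable mu : {measure set X -> \bar R}.
Implicit Types (V : X -> J -> set K) (L G : X -> J -> {linear H -> K}).

Definition semicontinuous_gframe V L : Prop :=
  [/\ forall x j, bounded_operator (V x j) (L x j),
      forall f j, borel_fun (fun x => L x j f) &
      exists A B : R, [/\ 0 < A, 0 < B & forall f : H,
        ((A * hnorm f ^+ 2)%:E <=
           \int[mu]_x (\esum_(j in [set: J]) (hnorm (L x j f) ^+ 2)%:E) <=
         (B * hnorm f ^+ 2)%:E)%E]].

(* \int_D \sum_j <G_{x,j} f, L_{x,j} g> dmu(x) *)
Definition pairing L G (D : set X) (f g : H) : R[i] :=
  integralC mu D (fun x => sumC (fun j => inner (G x j f) (L x j g))).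

(* v = \int_D \sum_j L_{x,j}^* G_{x,j} f dmu(x), in the weak sense. *)
Definition is_weak_integral L G (D : set X) (f v : H) : Prop :=
  forall g : H, inner v g = pairing L G D f g.

(* The vector \int_D \sum_j L_{x,j}^* G_{x,j} f dmu(x); it is 0 when there is
   no vector satisfying [is_weak_integral]. *)
Definition weak_integral L G (D : set X) (f : H) : H :=
  xget 0 [set v | is_weak_integral L G D f v].

Definition alternate_dual V L G : Prop :=
  semicontinuous_gframe V G /\
  (forall f, is_weak_integral L G [set: X] f f /\
             is_weak_integral G L [set: X] f f).

End GFrames.

(* Main.v *)
(* Write S f for the weak integral over X1 and S' f for the one over its
   complement. The sum of the |<G_{x,j} f, L_{x,j} g>| is dominated by that of
   |G_{x,j} f|^2 + |L_{x,j} g|^2, whose integral is controlled by the upper frame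
   bounds, so that g |-> pairing D f g is a bounded conjugate-linear form and
   S f, S' f exist by the Riesz representation theorem. Duality then says that
   f = S f + S' f. Substituting this for f on the right of Re <S f, f> and
   Re <S' f, f>, the equality becomes an identity in |S f|^2, |S' f|^2 and
   Re <S f, S' f>, and the difference of the two sides of the inequality is
   |(1 - lambda) S f - lambda S' f|^2. *)
Require Import Defs.
From HB Require Import structures.
From mathcomp Require Import all_boot all_order all_algebra.
From mathcomp Require Import all_classical all_reals all_analysis.
From mathcomp Require Import measurable_realfun sesquilinear complex.
From mathcomp Require Import ring lra.

Set Implicit Arguments.
Unset Strict Implicit.
Unset Printing Implicit Defensive.

Import Order.TTheory GRing.Theory Num.Theory.
Import numFieldNormedType.Exports.

Local Open Scope classical_set_scope.
Local Open Scope ring_scope.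

(** * Real and complex inner products, and identities for the norm *)

Section HilbertSpace.
Context {R : realType} {H : hilbertType R}.
Implicit Types u v w : H.

(** The inner product of [H] regarded as a real Hilbert space. *)
Definition rinner u v : R := complex.Re (inner u v).

Lemma innerC u v : inner u v = conjc (inner v u).
Proof. by rewrite (hermC inner u v) expr0 mul1r. Qed.

Lemma hnormE (W : normedModType R[i]) (u : W) : (hnorm u)%:C%C = `|u|.
Proof. by rewrite RRe_real// ger0_real. Qed.

Lemma hnorm_ge0 u : 0 <= hnorm u.
Proof. by rewrite -ler0c hnormE. Qed.

Lemma ReD (x y : R[i]) : complex.Re (x + y) = complex.Re x + complex.Re y.
Proof. by case: x; case: y. Qed.

Lemma ReN (x : R[i]) : complex.Re (- x) = - complex.Re x.
Proof. by case: x. Qed.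

Lemma ImD (x y : R[i]) : complex.Im (x + y) = complex.Im x + complex.Im y.
Proof. by case: x; case: y. Qed.

Lemma mulcRl (a : R) (z : R[i]) :
  a%:C%C * z = ((a * complex.Re z) +i* (a * complex.Im z))%C.
Proof. by case: z => x y; simpc. Qed.

Lemma mulNic (z : R[i]) : - 'i%C * z = (complex.Im z +i* - complex.Re z)%C.
Proof. by case: z => x y; simpc. Qed.

Lemma rinnerC u v : rinner u v = rinner v u.
Proof. by rewrite /rinner innerC; case: (inner v u). Qed.

Lemma rinnerDl u v w : rinner (u + v) w = rinner u w + rinner v w.
Proof. by rewrite /rinner linearDl ReD. Qed.

Lemma rinnerDr u v w : rinner u (v + w) = rinner u v + rinner u w.
Proof. by rewrite rinnerC rinnerDl !(rinnerC u). Qed.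

Lemma rinnerZl (a : R) u v : rinner (a%:C%C *: u) v = a * rinner u v.
Proof.
by rewrite /rinner linearZl_LR/=; case: (inner u v) => x y /=; rewrite mul0r subr0.
Qed.

Lemma rinnerZr (a : R) u v : rinner u (a%:C%C *: v) = a * rinner u v.
Proof. by rewrite rinnerC rinnerZl rinnerC. Qed.

Lemma rinnerNl u v : rinner (- u) v = - rinner u v.
Proof. by rewrite /rinner linearNl ReN. Qed.

Lemma rinnerNr u v : rinner u (- v) = - rinner u v.
Proof. by rewrite rinnerC rinnerNl rinnerC. Qed.

Lemma inner_mulir u v : inner u ('i%C *: v) = - 'i%C * inner u v.
Proof. by rewrite linearZr_LR/=; case: (inner u v) => x y; simpc. Qed.

(** The imaginary part of [inner] is thus itself a real inner product, so facts proved for [rinner]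
    carry over to it. *)
Lemma rinner_mulir u v : rinner u ('i%C *: v) = complex.Im (inner u v).
Proof. by rewrite /rinner inner_mulir; case: (inner u v) => x y; simpc. Qed.

Lemma hnorm2E u : hnorm u ^+ 2 = rinner u u.
Proof. by rewrite /rinner -normr_inner -hnormE -rmorphXn. Qed.

Lemma hnorm2D u v :
  hnorm (u + v) ^+ 2 = hnorm u ^+ 2 + hnorm v ^+ 2 + 2 * rinner u v.
Proof. rewrite !hnorm2E rinnerDl !rinnerDr (rinnerC v u); ring. Qed.

Lemma hnorm2B u v :
  hnorm (u - v) ^+ 2 = hnorm u ^+ 2 + hnorm v ^+ 2 - 2 * rinner u v.
Proof.
rewrite !hnorm2E rinnerDl !rinnerDr !rinnerNl !rinnerNr (rinnerC v u); ring.
Qed.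

Lemma hnorm2Z (a : R) u : hnorm (a%:C%C *: u) ^+ 2 = a ^+ 2 * hnorm u ^+ 2.
Proof. rewrite !hnorm2E rinnerZl rinnerZr; ring. Qed.

Lemma hnorm_mulir u : hnorm ('i%C *: u) = hnorm u.
Proof.
rewrite /hnorm normrZ normc_def/= expr0n expr1n add0r sqrtr1.
by rewrite mul1r.
Qed.

Lemma parallelogram u v :
  hnorm (u + v) ^+ 2 + hnorm (u - v) ^+ 2 = 2 * (hnorm u ^+ 2 + hnorm v ^+ 2).
Proof. rewrite hnorm2D hnorm2B; ring. Qed.

Lemma inner_inj u v : (forall w, inner u w = inner v w) -> u = v.
Proof.
move=> uv; have : `|u - v| ^+ 2 == 0 by rewrite normr_inner linearBl subr_eq0; exact/eqP/uv.
by rewrite expf_eq0/= normr_eq0 subr_eq0 => /eqP.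
Qed.

(** Expand [hnorm (u + v) ^+ 2] and [hnorm (u - v) ^+ 2], both nonnegative; for the imaginary part
    replace [v] by ['i *: v]. This additive form, rather than Cauchy-Schwarz, can be summed over [j]
    and integrated directly. *)
Lemma normr_inner_le u v :
  `|complex.Re (inner u v)| <= hnorm u ^+ 2 + hnorm v ^+ 2 /\
  `|complex.Im (inner u v)| <= hnorm u ^+ 2 + hnorm v ^+ 2.
Proof.
have P w : `|rinner u w| <= hnorm u ^+ 2 + hnorm w ^+ 2.
  have := sqr_ge0 (hnorm (u + w)); have := sqr_ge0 (hnorm (u - w)).
  rewrite hnorm2B hnorm2D => h1 h2.
  have := sqr_ge0 (hnorm u); have := sqr_ge0 (hnorm w) => h3 h4.
  rewrite ler_norml; apply/andP; split; lra.
by split; [exact: P|rewrite -rinner_mulir -(hnorm_mulir v); exact: P].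
Qed.

End HilbertSpace.

(** * The Riesz representation theorem *)

Section Riesz.
Context {R : realType} {H : hilbertType R}.
Implicit Types u v g : H.

Lemma hnorm_cauchy_cvg (u_ : nat -> H) :
  (forall e : R, 0 < e ->
    exists N, forall n, (N <= n)%N -> hnorm (u_ N - u_ n) < e) ->
  exists v, forall e : R, 0 < e -> \forall n \near \oo, hnorm (v - u_ n) < e.
Proof.
move=> cu.
have /cauchy_cvgP/cvg_ex[v uv] : cauchy (u_ @ \oo).
  apply/cauchy_exP => _/posnumP[e].
  have e0 : (0 : R[i]) < e%:num by [].
  (* A positive radius in [R[i]] has zero imaginary part, so the real hypothesis applies to its real
     part. *)
  move: e0; rewrite ltcE/= => /andP[/eqP e1 /cu[N NP]].
  exists (u_ N); exists N => // n /= /NP.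
  by rewrite -ball_normE/= -hnormE ltcE/= e1 eqxx.
exists v => e e0; have e0' : 0 < e%:C%C by rewrite ltcR.
move/cvgrPdist_lt : uv => /(_ _ e0'); apply: filterS => n.
by rewrite -hnormE ltcR.
Qed.

Section linear_form.
Variables (phi : H -> R) (C : R).
Hypothesis phiZ : forall (a : R) u, phi (a%:C%C *: u) = a * phi u.
Hypothesis phi_le : forall u, `|phi u| <= C * (1 + hnorm u ^+ 2).

Let C_ge0 : 0 <= C.
Proof.
have := phi_le 0; have := normr_ge0 (phi 0).
rewrite /hnorm normr0/= expr0n/= addr0 mulr1; exact: le_trans.
Qed.

(** Apply [phi_le] to [u / s] and multiply by [s]: the free scale [s] makes up for the bound not
    being homogeneous. *)
Lemma linear_form_scaled_le (s : R) u : 0 < s ->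
  `|phi u| <= C * (s + hnorm u ^+ 2 / s).
Proof.
move=> s0; have sN0 : s != 0 by rewrite gt_eqF.
have -> : u = s%:C%C *: (s^-1%:C%C *: u).
  by rewrite scalerA -rmorphM/= mulfV// scale1r.
rewrite phiZ normrM gtr0_norm// hnorm2Z.
have := ler_wpM2l (ltW s0) (phi_le (s^-1%:C%C *: u)).
move=> /le_trans; apply; rewrite hnorm2Z le_eqVlt; apply/orP; left; apply/eqP.
by field.
Qed.

(** Continuity at 0, with the radius itself taken as the scale. *)
Lemma linear_form_near0_le (s : R) u : 0 < s -> hnorm u <= s ->
  `|phi u| <= 2 * C * s.
Proof.
move=> s0 us; apply: le_trans (linear_form_scaled_le u s0) _.
have : hnorm u ^+ 2 / s <= s.
  by rewrite ler_pdivrMr// -expr2 lerXn2r// nnegrE ?hnorm_ge0// ltW.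
move=> h; have := ler_wpM2l C_ge0 h => h'; lra.
Qed.

End linear_form.

Section representation.
Variables (phi : H -> R) (C : R).
Hypothesis phiD : forall u v, phi (u + v) = phi u + phi v.
Hypothesis phiZ : forall (a : R) u, phi (a%:C%C *: u) = a * phi u.
Hypothesis phi_le : forall u, `|phi u| <= C * (1 + hnorm u ^+ 2).

(* The representing vector is the minimiser of Q, which exists because Q is
   bounded below and minimising sequences are Cauchy by the parallelogram law. *)
Let Q u := hnorm u ^+ 2 - 2 * phi u.

Let Q_lb : exists m, forall u, m <= Q u.
Proof.
have C0 : 0 <= C.
  have := phi_le 0; have := normr_ge0 (phi 0).
  rewrite /hnorm normr0/= expr0n/= addr0 mulr1; exact: le_trans.
(* At a scale [t] above [2 * C], the quadratic part of the bound on [2 * phi u] is absorbed by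
   [hnorm u ^+ 2]. *)
pose t := 2 * C + 1; have t0 : 0 < t by rewrite /t; lra.
exists (- (2 * (C * t))) => u.
have := linear_form_scaled_le phiZ phi_le u t0.
have : 2 * (C * (hnorm u ^+ 2 / t)) <= hnorm u ^+ 2.
  have -> : 2 * (C * (hnorm u ^+ 2 / t)) = (2 * C * hnorm u ^+ 2) / t.
    by rewrite !mulrA.
  rewrite ler_pdivrMr// /t; have := sqr_ge0 (hnorm u); nra.
have := ler_norm (phi u); rewrite /Q mulrDr; lra.
Qed.

Let Q_min : exists v, forall u, Q v <= Q u.
Proof.
pose E := range Q.
have E0 : has_inf E.
  split; first by exists (Q 0); exists 0.
  by have [m mQ] := Q_lb; exists m => _ [u _ <-].
have infE u : inf E <= Q u by apply: ge_inf; [exact: E0.2|exists u].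
have [g gP] : {g : nat -> H & forall n, Q (g n) < inf E + n.+1%:R^-1}.
  apply: (@choice _ _ (fun n v => Q v < inf E + n.+1%:R^-1)) => n.
  have n0 : 0 < n.+1%:R^-1 :> R by rewrite invr_gt0 ltr0n.
  by have [_ [v _ <-] Hv] := inf_adherent n0 E0; exists v.
(* By the parallelogram law the left side is [2 * Q (g n) + 2 * Q (g k)] minus four times the value
   of [Q] at the midpoint, and that value is at least [inf E]. *)
have dg n k : hnorm (g n - g k) ^+ 2 <= 2 * (n.+1%:R^-1 + k.+1%:R^-1).
  have h1 := gP n; have h2 := gP k.
  have := infE ((2^-1 : R)%:C%C *: (g n + g k)).
  move: h1 h2; rewrite /Q hnorm2Z phiZ phiD.
  have := parallelogram (g n) (g k).
  move: (n.+1%:R^-1) (k.+1%:R^-1) (inf E) => a b m; lra.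
have [v vP] : exists v, forall e : R, 0 < e ->
    \forall n \near \oo, hnorm (v - g n) < e.
  apply: hnorm_cauchy_cvg => e e0.
  have e4 : 0 < e ^+ 2 / 4 by rewrite divr_gt0// exprn_gt0.
  have [N _ NP] := near_infty_natSinv_lt (PosNum e4).
  exists N => n Nn; have /= N1 := NP N (leqnn N); have /= n1 := NP n Nn.
  rewrite -(@ltr_pXn2r _ 2)// ?nnegrE ?hnorm_ge0// ?ltW//.
  apply: le_lt_trans (dg N n) _.
  move: (N.+1%:R^-1) (n.+1%:R^-1) N1 n1 => a b; lra.
(* It remains to see that the limit attains the infimum. [Q v] exceeds [Q (g n)] by at most
   [2 * psi (v - g n)], and [psi] obeys a bound of the same shape as [phi], so it is small near
   0. *)
exists v => u; apply: le_trans (infE u); apply/ler_addgt0Pr => e e0.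
pose D := hnorm v ^+ 2 + 1 + C.
pose psi h := rinner v h - phi h.
have psiZ (a : R) h : psi (a%:C%C *: h) = a * psi h.
  by rewrite /psi rinnerZr phiZ mulrBr.
have psi_le h : `|psi h| <= D * (1 + hnorm h ^+ 2).
  rewrite /psi; apply: le_trans (ler_normB _ _) _.
  have := phi_le h; have [+ _] := normr_inner_le v h.
  rewrite -/(rinner v h) /D; have := sqr_ge0 (hnorm v).
  have := sqr_ge0 (hnorm h); nra.
have D0 : 0 < D.
  have := le_trans (normr_ge0 _) (psi_le 0).
  rewrite /hnorm normr0/= expr0n/= addr0 mulr1.
  have := le_trans (normr_ge0 _) (phi_le 0).
  rewrite /hnorm normr0/= expr0n/= addr0 mulr1 /D /hnorm.
  have := sqr_ge0 (complex.Re `|v|); lra.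
(* Then [2 * D * s = e / 4], so the [psi] term costs at most [e / 2]; the other half of [e] pays for
   [Q (g n) - inf E]. *)
pose s := e / (8 * D); have s0 : 0 < s by rewrite divr_gt0// mulr_gt0.
have e2 : 0 < e / 2 by rewrite divr_gt0.
have [n [h1 /ltW h2]] : exists n, (n.+1%:R^-1 < e / 2) /\ hnorm (v - g n) < s.
  have : \forall n \near \oo, (n.+1%:R^-1 < e / 2) /\ hnorm (v - g n) < s.
    near=> n; split; last by near: n; exact: vP.
    by near: n; exact: (near_infty_natSinv_lt (PosNum e2)).
  by move=> /filter_ex.
have := linear_form_near0_le psiZ psi_le s0 h2.
have -> : 2 * D * s = e / 4 by rewrite /s; field; rewrite gt_eqF.
have Qv : Q v = Q (g n) - hnorm (v - g n) ^+ 2 + 2 * psi (v - g n).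
  rewrite /Q /psi hnorm2B rinnerDr rinnerNr phiD -hnorm2E.
  have -> : phi (- g n) = - phi (g n).
    by have := phiZ (-1) (g n); rewrite rmorphN rmorph1 scaleN1r mulN1r.
  ring.
have := gP n; have := sqr_ge0 (hnorm (v - g n)); rewrite Qv.
have := ler_norm (psi (v - g n)).
move: (n.+1%:R^-1) (Q (g n)) (inf E) h1 => a q m h1; lra.
Unshelve. all: by end_near.
Qed.

Lemma real_riesz : exists v, forall u, rinner v u = phi u.
Proof.
have [v vP] := Q_min; exists v => u; apply/eqP; rewrite -subr_eq0.
set y := _ - _; pose N := hnorm u ^+ 2; have N0 : 0 <= N by exact: sqr_ge0.
(* Moving from [v] by [t] along [u] changes [Q] by [t ^+ 2 * N + 2 * t * y], which this [t] makes
   negative unless [y = 0]. The [+ 1] keeps the denominator positive when [u = 0]. *)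
pose t := - y / (N + 1).
have N1 : 0 < N + 1 by lra.
have := vP (v + t%:C%C *: u).
rewrite /Q hnorm2D hnorm2Z phiD phiZ rinnerZr -/N => h.
have : 0 <= t ^+ 2 * N + 2 * t * y by rewrite /y; lra.
have -> : t ^+ 2 * N + 2 * t * y = - (y ^+ 2 * ((N + 2) / (N + 1) ^+ 2)).
  by rewrite /t; field; rewrite gt_eqF.
rewrite oppr_ge0 pmulr_lle0; last by rewrite divr_gt0// ?exprn_gt0//; lra.
by rewrite le_eqVlt ltNge sqr_ge0 orbF sqrf_eq0.
Qed.

End representation.

(** Represent the real part of [phi] by [real_riesz]; evaluating at ['i *: u] then shows that the
    same vector gives the imaginary part. The second and third hypotheses together express
    conjugate-homogeneity. *)
Lemma riesz (phi : H -> R[i]) (C : R) :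
  (forall u v, phi (u + v) = phi u + phi v) ->
  (forall (a : R) u, phi (a%:C%C *: u) = a%:C%C * phi u) ->
  (forall u, phi ('i%C *: u) = - 'i%C * phi u) ->
  (forall u, `|complex.Re (phi u)| <= C * (1 + hnorm u ^+ 2)) ->
  exists v, forall u, inner v u = phi u.
Proof.
move=> phiD phiZ phii phi_le.
have [| |//|v vP] := @real_riesz (fun u => complex.Re (phi u)) C.
- by move=> u v; rewrite phiD ReD.
- by move=> a u; rewrite phiZ; case: (phi u) => x y /=; rewrite mul0r subr0.
exists v => u; apply/eqP; rewrite eq_complex; apply/andP; split; apply/eqP.
  exact: vP.
by rewrite -rinner_mulir vP phii; case: (phi u) => x y; simpc.
Qed.

End Riesz.

(** * Absolutely summable families over a countable index *)

Section CountableSum.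
Context {R : realType} {J : countType}.
Implicit Types (a b p q : J -> R) (c : R).

(** Reindexes by the codes of [J], with 0 at numbers that code nothing, so that results on series
    over [nat] apply. *)
Lemma esum_pickle (F : J -> \bar R) : (forall j, 0 <= F j)%E ->
  (\esum_(j in [set: J]) F j = \sum_(0 <= n <oo) oapp F 0 (pickle_inv n))%E.
Proof.
move=> F0; have F'0 n : (0 <= oapp F 0 (pickle_inv n))%E by case: pickle_inv => /=.
rewrite nneseries_esumT//.
transitivity (\esum_(n in range (@pickle J)) oapp F 0 (pickle_inv n))%E.
  rewrite esum_image; first by apply: eq_esum => j _; rewrite pickleK_inv.
  by move=> i j _ _ /(pcan_inj (@pickleK J)).
rewrite esum_mkcond; apply: eq_esum => n _; case: ifPn => // /negP nP.
have := @pickle_invK J n; case: pickle_inv => //= j jn.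
by exfalso; apply: nP; rewrite inE; exists j.
Qed.

Lemma esumZl c (F : J -> \bar R) : (forall j, 0 <= F j)%E -> 0 <= c ->
  (\esum_(j in [set: J]) (c%:E * F j) = c%:E * \esum_(j in [set: J]) F j)%E.
Proof.
move=> F0 c0; rewrite !esum_pickle//; last by move=> j; rewrite mule_ge0.
rewrite -nneseriesZl; last by move=> n _; case: pickle_inv => /=.
by apply: eq_eseriesr => n _; case: pickle_inv => //=; rewrite mule0.
Qed.

Lemma measurable_esum d (X : measurableType d) (F : X -> J -> \bar R) :
  (forall x j, 0 <= F x j)%E -> (forall j, measurable_fun setT (F ^~ j)) ->
  measurable_fun setT (fun x => \esum_(j in [set: J]) F x j)%E.
Proof.
move=> F0 mF; under eq_fun do rewrite esum_pickle//.
apply: (ge0_emeasurable_sum (P := xpredT)) => [n x _ _|n _].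
  by case: pickle_inv => /=.
by case: pickle_inv => [j|] /=; [exact: mF|exact: measurable_cst].
Qed.

(** Its finiteness is the condition under which [sumR a] is a genuine sum. *)
Definition asum a : \bar R := (\esum_(j in [set: J]) `|a j|%:E)%E.

Lemma asum_ge0 a : (0 <= asum a)%E.
Proof. by apply: esum_ge0 => j _; rewrite lee_fin. Qed.

Lemma le_asum_fin_num a b :
  (asum a <= asum b)%E -> (asum b < +oo)%E -> asum a \is a fin_num.
Proof. by move=> ab b_fin; rewrite ge0_fin_numE ?asum_ge0// (le_lt_trans ab). Qed.

Lemma asumD a b : (asum (a \+ b)%R <= asum a + asum b)%E.
Proof.
rewrite /asum -esumD; [|by move=> j _; rewrite lee_fin..].
by apply: le_esum => j _; rewrite -EFinD lee_fin ler_normD.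
Qed.

Lemma asumZ c a : asum (fun j => c * a j) = (`|c|%:E * asum a)%E.
Proof.
rewrite -esumZl//.
by rewrite /asum; apply: eq_esum => j _; rewrite normrM.
Qed.

Lemma asumN a : asum (fun j => - a j) = asum a.
Proof. by rewrite /asum; apply: eq_esum => j _; rewrite normrN. Qed.

Lemma asum_posneg a :
  (\esum_(j in [set: J]) (a^\+ j)%:E <= asum a /\
   \esum_(j in [set: J]) (a^\- j)%:E <= asum a)%E.
Proof.
split; apply: le_esum => j _; rewrite lee_fin; rewrite /funrpos /funrneg ge_max.
  by rewrite ler_norm normr_ge0.
by rewrite -normrN ler_norm normr_ge0.
Qed.

Lemma asum_funrpos a : (asum a^\+%R <= asum a)%E.
Proof.
apply: le_trans (asum_posneg a).1; apply: le_esum => j _.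
by rewrite ger0_norm.
Qed.

Lemma asum_funrneg a : (asum a^\-%R <= asum a)%E.
Proof.
apply: le_trans (asum_posneg a).2; apply: le_esum => j _.
by rewrite ger0_norm.
Qed.

Lemma sumRE a : sumR a = fine (asum a^\+) - fine (asum a^\-).
Proof.
by rewrite /sumR; congr (fine _ - fine _); apply: eq_esum => j _; rewrite ger0_norm.
Qed.

(** Any splitting into summable nonnegative families computes [sumR], not only the one into positive
    and negative parts; additivity rests on this. *)
Lemma sumRB p q : (forall j, 0 <= p j) -> (forall j, 0 <= q j) ->
  (asum p < +oo)%E -> (asum q < +oo)%E ->
  sumR (p \- q) = fine (asum p) - fine (asum q).
Proof.
move=> p0 q0 sp sq.
have := @esumB R J setT (EFin \o p) (EFin \o q) sp sq
  (fun j _ => p0 j) (fun j _ => q0 j).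
have -> : ((EFin \o p) \- (EFin \o q))%E = EFin \o (p \- q) by exact/funext.
rewrite funerpos funerneg.
have asumE r : (forall j, 0 <= r j) ->
    (\esum_(j in [set: J]) (EFin \o r) j = asum r)%E.
  by move=> r0; apply: eq_esum => j _; rewrite ger0_norm.
rewrite !asumE// => Epq.
have sb : (asum (p \- q)%R < +oo)%E.
  apply: le_lt_trans (asumD p (fun j => - q j)) _.
  by rewrite asumN lte_add_pinfty.
have fp : asum p \is a fin_num by exact: le_asum_fin_num (lexx _) sp.
have fq : asum q \is a fin_num by exact: le_asum_fin_num (lexx _) sq.
rewrite -fineB// -Epq fineB ?sumRE//.
- exact: le_asum_fin_num (asum_funrpos _) sb.
- exact: le_asum_fin_num (asum_funrneg _) sb.
Qed.

Lemma sumRD a b : (asum a < +oo)%E -> (asum b < +oo)%E ->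
  sumR (a \+ b) = sumR a + sumR b.
Proof.
move=> sa sb.
(* In general this is not the splitting of [a \+ b] into its own positive and negative parts, hence
   the use of [sumRB]. *)
have -> : a \+ b = (a^\+ \+ b^\+) \- (a^\- \+ b^\-).
  by rewrite -[LHS]funrDB.
have fin := le_asum_fin_num.
have fa := asum_funrpos a; have fa' := asum_funrneg a.
have fb := asum_funrpos b; have fb' := asum_funrneg b.
have asumDE r s : (forall j, 0 <= r j) -> (forall j, 0 <= s j) ->
    asum (r \+ s) = (asum r + asum s)%E.
  move=> r0 s0; rewrite /asum -esumD; [|by move=> j _; rewrite lee_fin..].
  by apply: eq_esum => j _; rewrite !ger0_norm// addr_ge0.
rewrite sumRB ?asumDE//; last 4 first.
- by move=> j; rewrite addr_ge0.
- by move=> j; rewrite addr_ge0.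
- by rewrite lte_add_pinfty// ltey_eq ?(fin _ _ fa)// (fin _ _ fb).
- by rewrite lte_add_pinfty// ltey_eq ?(fin _ _ fa')// (fin _ _ fb').
rewrite !fineD ?(fin _ _ fa) ?(fin _ _ fb) ?(fin _ _ fa') ?(fin _ _ fb')//.
by rewrite !sumRE opprD addrACA.
Qed.

Lemma sumRZ c a : (asum a < +oo)%E -> sumR (fun j => c * a j) = c * sumR a.
Proof.
have pos e b : 0 <= e -> (asum b < +oo)%E ->
    sumR (fun j => e * b j) = e * sumR b.
  move=> e0 sb; rewrite sumRE sumRE mulrBr.
  have -> : (fun j => e * b j)^\+ = fun j => e * b^\+ j.
    by apply/funext => j; rewrite /funrpos maxr_pMr// mulr0.
  have -> : (fun j => e * b j)^\- = fun j => e * b^\- j.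
    by apply/funext => j; rewrite /funrneg maxr_pMr// mulr0 mulrN.
  rewrite !asumZ ger0_norm// !fineM//.
  - exact: le_asum_fin_num (asum_funrneg _) sb.
  - exact: le_asum_fin_num (asum_funrpos _) sb.
move=> sa; have [c0|/ltW c0] := leP 0 c; first exact: pos.
(* A negative scalar is moved to [- c >= 0] and [- a]; negation exchanges the two parts. *)
have -> : (fun j => c * a j) = (fun j => - c * (- a j)).
  by apply/funext => j; rewrite mulrNN.
rewrite pos ?oppr_ge0 ?asumN//.
have -> : sumR (fun j => - a j) = - sumR a.
  rewrite !sumRE opprB; congr (fine (asum _) - fine (asum _)).
  exact: (funrnegN a).
by rewrite mulrNN.
Qed.

(** If [asum a] is infinite the bound is trivial, whatever junk [sumR a] is; otherwise both parts
    have sums in [[0, asum a]]. *)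
Lemma normr_sumR_le a : (`|sumR a|%:E <= asum a)%E.
Proof.
have [fa|] := boolP (asum a \is a fin_num); last first.
  by rewrite ge0_fin_numE ?asum_ge0// -leNgt leye_eq => /eqP ->; rewrite leey.
have pos (b : \bar R) : (0 <= b)%E -> (b <= asum a)%E -> 0 <= fine b <= fine (asum a).
  move=> b0 ba; rewrite fine_ge0//= fine_le// ge0_fin_numE//.
  by rewrite (le_lt_trans ba)// ltey_eq fa.
have /andP[p1 p2] := pos _ (asum_ge0 _) (asum_funrpos a).
have /andP[n1 n2] := pos _ (asum_ge0 _) (asum_funrneg a).
rewrite sumRE -(fineK fa) lee_fin ler_norml; apply/andP; split; lra.
Qed.

Lemma measurable_asum d (X : measurableType d) (A : X -> J -> R) :
  (forall j, measurable_fun setT (A ^~ j)) ->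
  measurable_fun setT (fun x => asum (A x)).
Proof.
move=> mA; apply: measurable_esum => [x j|j]; first by rewrite lee_fin.
by apply/measurable_EFinP; exact: measurableT_comp.
Qed.

Lemma measurable_sumR d (X : measurableType d) (A : X -> J -> R) :
  (forall j, measurable_fun setT (A ^~ j)) ->
  measurable_fun setT (fun x => sumR (A x)).
Proof.
move=> mA; under eq_fun do rewrite sumRE.
apply: measurable_funB; apply: measurableT_comp => //;
  apply: (measurable_asum (A := fun x => _)) => j.
- exact: measurable_funrpos (mA j).
- exact: measurable_funrneg (mA j).
Qed.

End CountableSum.

(** * Integrals of sums of families of functions *)

Section FamilyIntegral.
Context d {X : measurableType d} {R : realType} {J : countType}.
Variable mu : {measure set X -> \bar R}.
Implicit Types (A B : X -> J -> R) (D : set X) (c : R).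

(** Absolute integrability for [mu] times the counting measure on [J], as an iterated integral. *)
Definition integrable_family A :=
  (forall j, measurable_fun setT (A ^~ j)) /\
  (\int[mu]_x asum (A x) < +oo)%E.

Lemma integrable_asum A : integrable_family A ->
  mu.-integrable setT (fun x => asum (A x)).
Proof.
move=> [mA iA]; apply/integrableP; split; first exact: measurable_asum.
by under eq_integral do rewrite gee0_abs ?asum_ge0//.
Qed.

Lemma integrable_sumR A : integrable_family A ->
  mu.-integrable setT (EFin \o (fun x => sumR (A x))).
Proof.
move=> iA; apply: le_integrable (integrable_asum iA) => //.
  by apply/measurable_EFinP; exact: measurable_sumR iA.1.
by move=> x _; rewrite (gee0_abs (asum_ge0 _)); exact: normr_sumR_le.
Qed.

Lemma integrable_sumRS A D : measurable D -> integrable_family A ->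
  mu.-integrable D (EFin \o (fun x => sumR (A x))).
Proof. by move=> mD /integrable_sumR; exact: integrableS. Qed.

Lemma ae_asum_lty A : integrable_family A ->
  {ae mu, forall x, (asum (A x) < +oo)%E}.
Proof.
move=> /integrable_asum/(integrable_ae measurableT); apply: filterS => x /(_ I).
by rewrite ge0_fin_numE// asum_ge0.
Qed.

Lemma integrable_familyD A B : integrable_family A -> integrable_family B ->
  integrable_family (fun x => A x \+ B x).
Proof.
move=> iA iB; split; first by move=> j; exact: measurable_funD (iA.1 j) (iB.1 j).
apply: (@le_lt_trans _ _ (\int[mu]_x (asum (A x) + asum (B x)))%E).
  apply: ge0_le_integral => //.
  - by move=> x _; exact: asum_ge0.
  - by apply: (measurable_asum (A := fun x => _)) => j;
      exact: measurable_funD (iA.1 j) (iB.1 j).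
  - by apply: emeasurable_funD; apply: measurable_asum; [exact: iA.1|exact: iB.1].
  - by move=> x _; exact: asumD.
rewrite ge0_integralD//; first by rewrite lte_add_pinfty ?iA.2 ?iB.2.
- by move=> x _; exact: asum_ge0.
- exact: measurable_asum iA.1.
- by move=> x _; exact: asum_ge0.
- exact: measurable_asum iB.1.
Qed.

Lemma integrable_familyZ c A : integrable_family A ->
  integrable_family (fun x j => c * A x j).
Proof.
move=> iA; split; first by move=> j; exact: measurable_funM (measurable_cst _) (iA.1 j).
under eq_integral do rewrite asumZ.
rewrite ge0_integralZl//; last 2 first.
- exact: measurable_asum iA.1.
- by move=> x _; exact: asum_ge0.
by rewrite lte_mul_pinfty// iA.2.
Qed.

(** [sumRD] needs finite absolute sums, which are available only almost everywhere, so the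
    integrands are compared up to a null set. *)
Lemma Rintegral_sumRD A B D : measurable D ->
  integrable_family A -> integrable_family B ->
  \int[mu]_(x in D) sumR (A x \+ B x) =
  \int[mu]_(x in D) sumR (A x) + \int[mu]_(x in D) sumR (B x).
Proof.
move=> mD iA iB; rewrite -RintegralD//; [|exact: integrable_sumRS..].
have iAB := integrable_familyD iA iB.
congr fine; apply: ae_eq_integral => //.
- exact: measurable_int (integrable_sumRS mD iAB).
- under eq_fun do rewrite EFinD.
  apply: emeasurable_funD; apply: measurable_int.
    exact: (integrable_sumRS mD iA).
  exact: (integrable_sumRS mD iB).
have := ae_asum_lty iA; have := ae_asum_lty iB.
by apply: filterS2 => x a b _; rewrite sumRD.
Qed.

Lemma Rintegral_sumRZ c A D : measurable D -> integrable_family A ->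
  \int[mu]_(x in D) sumR (fun j => c * A x j) = c * \int[mu]_(x in D) sumR (A x).
Proof.
move=> mD iA; rewrite -RintegralZl//; last exact: integrable_sumRS.
have icA := integrable_familyZ c iA.
congr fine; apply: ae_eq_integral => //.
- exact: measurable_int (integrable_sumRS mD icA).
- under eq_fun do rewrite EFinM.
  apply: emeasurable_funM => //; apply: measurable_int.
  exact: (integrable_sumRS mD iA).
by apply: filterS (ae_asum_lty iA) => x a _; rewrite sumRZ.
Qed.

Lemma Rintegral_sumR_setC A D : measurable D -> integrable_family A ->
  \int[mu]_x sumR (A x) =
  \int[mu]_(x in D) sumR (A x) + \int[mu]_(x in ~` D) sumR (A x).
Proof.
move=> mD iA; rewrite -Rintegral_setU ?setUv//.
- exact: measurableC.
- exact: integrable_sumR.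
- by apply/disj_setPCl.
Qed.

Lemma normr_Rintegral_sumR_le A D : measurable D -> integrable_family A ->
  (`|\int[mu]_(x in D) sumR (A x)|%:E <= \int[mu]_x asum (A x))%E.
Proof.
move=> mD iA; rewrite EFin_normr_Rintegral//; last exact: integrable_sumRS.
have iAD := integrable_sumRS mD iA.
apply: le_trans (le_abse_integral _ mD (measurable_int _ iAD)) _.
apply: (@le_trans _ _ (\int[mu]_(x in D) asum (A x))%E).
  apply: ge0_le_integral => //.
  - by apply: measurableT_comp => //; exact: measurable_int iAD.
  - by apply: measurable_funTS; exact: measurable_asum iA.1.
  - by move=> x _; exact: normr_sumR_le.
apply: ge0_subset_integral => //; first exact: measurable_asum iA.1.
by move=> x _; exact: asum_ge0.
Qed.

End FamilyIntegral.

(** * From Borel measurable vector functions to measurable real functions *)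

Section BorelFun.
Context {R : realType} d {X : measurableType d}.

(** Open intervals generate the Borel sets of [R], and their preimages under [c] are open. *)
Lemma borel_fun_comp (Y : ptopologicalType) (h : X -> Y) (c : Y -> R) :
  borel_fun h -> continuous c -> measurable_fun setT (c \o h).
Proof.
move=> bh /continuousP cc.
apply: (measurability _ (RGenOpens.measurableE R)) => _ [_ [a [b ->] <-]].
rewrite comp_preimage; apply: bh => //; apply: sub_sigma_algebra.
exact/cc/interval_open.
Qed.

Lemma lipschitz1_continuous (Y : normedModType R[i]) (c : Y -> R) :
  (forall u v, (`|c u - c v|)%:C%C <= `|u - v|) -> continuous c.
Proof.
move=> lip u; apply/cvgrPdist_lt => e e0.
have e0' : 0 < e%:C%C by rewrite ltcR.
have : (v @[v --> u]) --> u by exact: cvg_id.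
move/cvgrPdist_lt => /(_ _ e0'); apply: filterS => v uv.
by rewrite -ltcR (le_lt_trans (lip _ _)).
Qed.

Lemma continuous_Re : continuous (@complex.Re R : R[i]^o -> R).
Proof.
apply: lipschitz1_continuous => u v.
by apply: le_trans (normc_ge_Re (u - v)); case: u; case: v.
Qed.

Lemma continuous_Im : continuous (@complex.Im R : R[i]^o -> R).
Proof.
apply: lipschitz1_continuous => u v.
(* Multiplication by ['i] preserves the modulus and turns the imaginary part, up to sign, into a
   real part; the sign explains the swap of [u] and [v]. *)
have -> : `|u - v| = `|(v - u) * 'i%C|.
  by rewrite normrM [`|'i%C|]normc_def/= expr0n expr1n add0r sqrtr1 mulr1 distrC.
apply: le_trans (normc_ge_Re _); rewrite ReiNIm lecR.
by case: u => a b; case: v => e f; rewrite /= opprB.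
Qed.

Lemma continuous_hnorm (H : normedModType R[i]) : continuous (@hnorm R H).
Proof.
apply: lipschitz1_continuous => u v.
apply: le_trans (ler_dist_dist u v).
by rewrite -(hnormE u) -(hnormE v) -rmorphB/= normc_def /= expr0n addr0 sqrtr_sqr.
Qed.

End BorelFun.

(** * The pairing as a bounded conjugate-linear form *)

Section Pairing.
Context {d : measure_display} {X : measurableType d} {R : realType}.
Context {J : countType} {H K : hilbertType R}.
Variables (mu : {measure set X -> \bar R}) (V : X -> J -> set K).
Variables L G : X -> J -> {linear H -> K}.
Hypotheses (hL : semicontinuous_gframe mu V L)
  (hG : semicontinuous_gframe mu V G).
Hypothesis hmeas : forall (f g : H) (j : J),
  @borel_fun d X R[i]^o (fun x => inner (G x j f) (L x j g)).

Let RA f g x j := complex.Re (inner (G x j f) (L x j g)).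
Let IA f g x j := complex.Im (inner (G x j f) (L x j g)).

Let energy (T : X -> J -> {linear H -> K}) f x : \bar R :=
  (\esum_(j in [set: J]) (hnorm (T x j f) ^+ 2)%:E)%E.

Lemma measurable_energy T f : semicontinuous_gframe mu V T ->
  measurable_fun setT (energy T f).
Proof.
move=> [_ mT _]; apply: measurable_esum => [x j|j].
  by rewrite lee_fin sqr_ge0.
apply/measurable_EFinP; apply: measurable_funX.
exact: borel_fun_comp (mT f j) (@continuous_hnorm _ _).
Qed.

Lemma energy_ge0 T f x : (0 <= energy T f x)%E.
Proof. by apply: esum_ge0 => j _; rewrite lee_fin sqr_ge0. Qed.

(** Termwise [normr_inner_le] bounds both integrals by the energies of [G] at [f] and of [L] at [g],
    hence by [BG * hnorm f ^+ 2 + BL * hnorm g ^+ 2]. The constant depends on [f] only, and the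
    bound is in the form that [riesz] expects. *)
Lemma pairing_family_bound f : exists2 C : R, 0 <= C & forall g,
  (\int[mu]_x asum (RA f g x) <= (C * (1 + hnorm g ^+ 2))%:E)%E /\
  (\int[mu]_x asum (IA f g x) <= (C * (1 + hnorm g ^+ 2))%:E)%E.
Proof.
have [_ _ [AL [BL [_ BL0 hBL]]]] := hL.
have [_ _ [AG [BG [_ BG0 hBG]]]] := hG.
exists (BG * hnorm f ^+ 2 + BL).
  by apply: addr_ge0; [apply: mulr_ge0; [exact: ltW|exact: sqr_ge0]|exact: ltW].
move=> g.
have iE : (\int[mu]_x (energy G f x + energy L g x) <=
    ((BG * hnorm f ^+ 2 + BL) * (1 + hnorm g ^+ 2))%:E)%E.
  rewrite ge0_integralD//; [|by move=> x _; exact: energy_ge0|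
    exact: measurable_energy|by move=> x _; exact: energy_ge0|
    exact: measurable_energy].
  have /andP[_ hf] := hBG f; have /andP[_ hg] := hBL g.
  apply: le_trans (leeD hf hg) _; rewrite -EFinD lee_fin.
  have := sqr_ge0 (hnorm f); have := sqr_ge0 (hnorm g).
  move: (hnorm f ^+ 2) (hnorm g ^+ 2) => a b b0 a0.
  have : 0 <= BG * a * b by apply: mulr_ge0 => //; apply: mulr_ge0 => //; exact: ltW.
  by move=> h; lra.
have mE : measurable_fun setT (fun x => energy G f x + energy L g x)%E.
  by apply: emeasurable_funD; exact: measurable_energy.
split; apply: le_trans iE; apply: ge0_le_integral => //.
- by move=> x _; exact: asum_ge0.
- by apply: measurable_asum => j;
    exact: borel_fun_comp (hmeas f g j) continuous_Re.
- move=> x _; rewrite -esumD; [|by move=> j _; rewrite lee_fin sqr_ge0..].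
  apply: le_esum => j _; rewrite -EFinD lee_fin.
  exact: (normr_inner_le _ _).1.
- by move=> x _; exact: asum_ge0.
- by apply: measurable_asum => j;
    exact: borel_fun_comp (hmeas f g j) continuous_Im.
- move=> x _; rewrite -esumD; [|by move=> j _; rewrite lee_fin sqr_ge0..].
  apply: le_esum => j _; rewrite -EFinD lee_fin.
  exact: (normr_inner_le _ _).2.
Qed.

Lemma integrable_pairing_family f g :
  integrable_family mu (RA f g) /\ integrable_family mu (IA f g).
Proof.
have [C _ /(_ g)[hR hI]] := pairing_family_bound f.
split; split.
- by move=> j; exact: borel_fun_comp (hmeas f g j) continuous_Re.
- by apply: le_lt_trans hR _; rewrite ltry.
- by move=> j; exact: borel_fun_comp (hmeas f g j) continuous_Im.
- by apply: le_lt_trans hI _; rewrite ltry.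
Qed.

Lemma pairingE D f g : pairing mu L G D f g =
  ((\int[mu]_(x in D) sumR (RA f g x)) +i*
   (\int[mu]_(x in D) sumR (IA f g x)))%C.
Proof. by []. Qed.

Lemma pairingDr D f g h : measurable D ->
  pairing mu L G D f (g + h) = pairing mu L G D f g + pairing mu L G D f h.
Proof.
move=> mD; have [iR iI] := integrable_pairing_family f g.
have [iR' iI'] := integrable_pairing_family f h.
have eR : RA f (g + h) = fun x => RA f g x \+ RA f h x.
  by apply/funext => x; apply/funext => j; rewrite /RA linearD linearDr ReD.
have eI : IA f (g + h) = fun x => IA f g x \+ IA f h x.
  by apply/funext => x; apply/funext => j; rewrite /IA linearD linearDr ImD.
rewrite !pairingE eR eI.
by rewrite (Rintegral_sumRD mD iR iR') (Rintegral_sumRD mD iI iI').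
Qed.

Lemma pairingZr D (a : R) f g : measurable D ->
  pairing mu L G D f (a%:C%C *: g) = a%:C%C * pairing mu L G D f g.
Proof.
move=> mD; have [iR iI] := integrable_pairing_family f g.
have eR : RA f (a%:C%C *: g) = fun x j => a * RA f g x j.
  by apply/funext => x; apply/funext => j; rewrite /RA linearZ; exact: rinnerZr.
have eI : IA f (a%:C%C *: g) = fun x j => a * IA f g x j.
  apply/funext => x; apply/funext => j; rewrite /IA linearZ linearZr_LR/=.
  by rewrite oppr0 mulcRl.
rewrite !pairingE eR eI mulcRl.
by rewrite (Rintegral_sumRZ a mD iR) (Rintegral_sumRZ a mD iI).
Qed.

Lemma pairing_mulir D f g : measurable D ->
  pairing mu L G D f ('i%C *: g) = - 'i%C * pairing mu L G D f g.
Proof.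
move=> mD; have [iR iI] := integrable_pairing_family f g.
have eR : RA f ('i%C *: g) = IA f g.
  by apply/funext => x; apply/funext => j; rewrite /RA linearZ; exact: rinner_mulir.
have eI : IA f ('i%C *: g) = fun x j => -1 * RA f g x j.
  apply/funext => x; apply/funext => j.
  by rewrite /IA linearZ/= inner_mulir mulNic mulN1r.
rewrite !pairingE eR eI mulNic (Rintegral_sumRZ (-1) mD iR).
by rewrite [_ * _]mulN1r.
Qed.

Lemma pairing_setC D f g : measurable D ->
  pairing mu L G setT f g = pairing mu L G D f g + pairing mu L G (~` D) f g.
Proof.
move=> mD; have [iR iI] := integrable_pairing_family f g.
rewrite !pairingE.
by rewrite (Rintegral_sumR_setC mD iR) (Rintegral_sumR_setC mD iI).
Qed.

(** [riesz] supplies a representing vector, so [xget] returns a true weak integral and not merely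
    its default 0. *)
Lemma weak_integralP D f : measurable D ->
  is_weak_integral mu L G D f (weak_integral mu L G D f).
Proof.
move=> mD; have [C C0 hC] := pairing_family_bound f.
have [| | | |v vP] := @riesz R H (pairing mu L G D f) C.
- by move=> u v; exact: pairingDr.
- by move=> a u; exact: pairingZr.
- by move=> u; exact: pairing_mulir.
- move=> u; rewrite pairingE/= -lee_fin; apply: le_trans (hC u).1.
  exact: normr_Rintegral_sumR_le mD (integrable_pairing_family f u).1.
exact: (@xgetPex _ 0 [set v | is_weak_integral mu L G D f v] (ex_intro _ v vP)).
Qed.

End Pairing.

Theorem theorem3p9 (R : realType) (d : measure_display) (X : measurableType d)
    (mu : {measure set X -> \bar R}) (J : countType) (H K : hilbertType R)
    (V : X -> J -> set K) (L G : X -> J -> {linear H -> K})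
    (hV : forall x j, closed_subspace (V x j))
    (hL : semicontinuous_gframe mu V L)
    (hG : alternate_dual mu V L G)
    (hmeas : forall (f g : H) (j : J),
      @borel_fun d X R[i]^o (fun x => inner (G x j f) (L x j g)))
    (lambda : R) (hlambda : 0 <= lambda <= 1)
    (X1 : set X) (hX1 : measurable X1) (f : H) :
  [/\ is_weak_integral mu L G X1 f (weak_integral mu L G X1 f),
      is_weak_integral mu L G (~` X1) f (weak_integral mu L G (~` X1) f),
      complex.Re (pairing mu L G (~` X1) f f)
        + hnorm (weak_integral mu L G X1 f) ^+ 2 =
      complex.Re (pairing mu L G X1 f f)
        + hnorm (weak_integral mu L G (~` X1) f) ^+ 2 &
      complex.Re (pairing mu L G X1 f f)
        + hnorm (weak_integral mu L G (~` X1) f) ^+ 2 >=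
      (2 * lambda - lambda ^+ 2) * complex.Re (pairing mu L G X1 f f)
        + (1 - lambda ^+ 2) * complex.Re (pairing mu L G (~` X1) f f)].
Proof.
have [hG1 hGdual] := hG.
have mC : measurable (~` X1) by exact: measurableC.
have w1 := weak_integralP hL hG1 hmeas f hX1.
have w2 := weak_integralP hL hG1 hmeas f mC.
move: w1 w2; set v1 := weak_integral _ _ _ X1 f.
set v2 := weak_integral _ _ _ (~` X1) f => w1 w2.
(* Both sides have the same inner product with every [g]: duality integrates over all of [X], and
   the integral splits along [X1]. *)
have fE : f = v1 + v2.
  apply: inner_inj => g.
  by rewrite linearDl (hGdual f).1 (pairing_setC hL hG1 hmeas f g hX1) -w1 -w2.
(* The pairing is [inner v1 f]; only its second argument is expanded by [fE]. *)
have p1 : complex.Re (pairing mu L G X1 f f) = hnorm v1 ^+ 2 + rinner v1 v2.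
  by rewrite -w1 -/(rinner _ _) [X in rinner v1 X]fE rinnerDr -hnorm2E.
have p2 : complex.Re (pairing mu L G (~` X1) f f) =
    rinner v1 v2 + hnorm v2 ^+ 2.
  by rewrite -w2 -/(rinner _ _) [X in rinner v2 X]fE rinnerDr rinnerC -hnorm2E.
split; [exact: w1|exact: w2|rewrite p1 p2; ring|rewrite p1 p2 -subr_ge0].
(* The expansion of this square is exactly the difference of the two sides once [p1] and [p2] are
   substituted. *)
have := sqr_ge0 (hnorm ((1 - lambda)%:C%C *: v1 - lambda%:C%C *: v2)).
rewrite hnorm2B !hnorm2Z rinnerZl rinnerZr => /le_trans; apply.
rewrite le_eqVlt; apply/orP; left; apply/eqP; ring.
Qed.
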